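(* Let $X$ be an algebraic variety over $k$ with field of rational functions $K_X$, and let $\partial\colon K_X\to K_X$ be a rational semisimple derivation. Then an element $s\in K_X$ is a rational slice of the rational $\mathbb{G}_{\mathrm{m}}$-action $\phi_\partial$, i.e. $\phi_\partial^*(s)=ts$, if and only if $\partial(s)=s$.
   Context: Let $k$ be an algebraically closed field of characteristic zero. A variety is an integral separated scheme of finite type over $k$; $K_X$ is the field of rational functions of $X$. All derivations are $k$-derivations. A derivation $\partial\colon K_X\to K_X$ is rational semisimple if there is a generating set $\{a_i\}_{i\in I}$ of $K_X$ (as a field) such that $\partial(a_i)=\lambda_i a_i$ with $\lambda_i\in\mathbb{Z}$ for all $i\in I$. Let $\exp(z\partial)\colon K_X\to K_X[[z]]$, $f\mapsto\sum_{i\ge0}\frac{z^i\partial^i(f)}{i!}$, and let $\sigma\colon K_X[[z]]\to K_X[[t-1]]$ be the isomorphism of power series rings over $K_X$ given by $z\mapsto\sum_{i\ge1}(-1)^{i+1}\frac{(t-1)^i}{i}$. Put $\phi_\partial^*=\sigma\circ\exp(z\partial)\colon K_X\to K_X[[t-1]]$. For $\partial$ rational semisimple, the image of $\phi_\partial^*$ lies in $K_X(t)\cap K_X[[t-1]]$ and $\phi_\partial^*$ is the comorphism of a rational $\mathbb{G}_{\mathrm{m}}$-action $\phi_\partial\colon\mathbb{G}_{\mathrm{m}}\times X\dashrightarrow X$, where $t$ is the coordinate on $\mathbb{G}_{\mathrm{m}}$. A rational slice of a rational $\mathbb{G}_{\mathrm{m}}$-action $\varphi$ with comorphism $\varphi^*\colon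 K_X\to K_X(t)$ is an element $s\in K_X$ such that $\varphi^*(s)=ts$. *)

(* Defs.v *)
From HB Require Import structures.
From mathcomp Require Import all_boot all_order all_algebra.
From mathcomp Require Import boolp classical_sets.
Set Implicit Arguments.
Unset Strict Implicit.
Unset Printing Implicit Defensive.
Import GRing.Theory.
Local Open Scope ring_scope.

Section FieldExtensions.
Variables (k K : fieldType) (iota : {rmorphism k -> K}).

(* The smallest subfield of K that contains iota(k) and all the a i.  The
   case of inverses needs no side condition, since 0^-1 = 0 in K. *)
Inductive generated_subfield (I : Type) (a : I -> K) : K -> Prop :=
| gen_base i : generated_subfield a (a i)
| gen_scalar c : generated_subfield a (iota c)
| gen_sub f g : generated_subfield a f -> generated_subfield a g ->
    generated_subfield a (f - g)
| gen_mul f g : generated_subfield a f -> generated_subfield a g ->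
    generated_subfield a (f * g)
| gen_inv f : generated_subfield a f -> generated_subfield a f^-1.

Definition generates (I : Type) (a : I -> K) : Prop :=
  forall f, generated_subfield a f.

(* The function fields of varieties over k are, up to isomorphism over k,
   exactly the finitely generated field extensions of k: K_X is the fraction
   field of the coordinate ring of any nonempty affine open subset of X, and
   conversely k(a_1, ..., a_n) is the function field of Spec k[a_1, ..., a_n]. *)
Definition is_function_field : Prop :=
  exists (n : nat) (a : 'I_n -> K), generates a.

Record is_derivation (D : K -> K) : Prop := IsDerivation {
  derivationD : forall f g, D (f + g) = D f + D g;
  derivationZ : forall c f, D (iota c * f) = iota c * D f;
  derivationM : forall f g, D (f * g) = D f * g + f * D g
}.

(* Since D vanishes on iota(k), elements of iota(k) may always be added to the
   family a with weight 0, so generation over k and generation over the prime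
   field give the same notion. *)
Definition rational_semisimple (D : K -> K) : Prop :=
  is_derivation D /\
  exists (I : Type) (a : I -> K) (lambda : I -> int),
    generates a /\ forall i, D (a i) = (lambda i)%:~R * a i.

End FieldExtensions.

Section FormalSeries.
Variable K : fieldType.

(* Coefficient sequences of formal power series in one variable over K. *)
Definition series := nat -> K.

Definition series_one : series := fun n => (n == 0%N)%:R.

Definition series_mul (a b : series) : series :=
  fun n => \sum_(i < n.+1) a i * b (n - i)%N.

Definition series_pow (a : series) (n : nat) : series :=
  iter n (series_mul a) series_one.

(* a(b) = \sum_n a_n b^n, for b with zero constant term: b^n then has no
   coefficient in degrees m < n, so the sum for the m-th coefficient is finite. *)
Definition series_subst (b a : series) : series :=
  fun m => \sum_(n < m.+1) a n * series_pow b n m.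

(* \sum_(i >= 1) (-1)^(i+1) (t-1)^i / i, as a series in t - 1. *)
Definition log_series : series :=
  fun i => if i is 0%N then 0 else (-1) ^+ i.+1 / i%:R.

(* exp(zD) : K -> K[[z]] *)
Definition exp_series (D : K -> K) (f : K) : series :=
  fun i => iter i D f / (i`!)%:R.

(* sigma : K[[z]] -> K[[t-1]] *)
Definition sigma : series -> series := series_subst log_series.

Definition phi_series (D : K -> K) (f : K) : series := sigma (exp_series D f).

End FormalSeries.

Notation ratfun K := {fraction {poly K}}.

Section RationalSlices.
Variable K : fieldType.

Definition ratfun_t : ratfun K := tofrac ('X : {poly K}).

Definition ratfun_const (s : K) : ratfun K := tofrac s%:P.

(* The polynomial p(t), written as a series in t - 1. *)
Definition poly_series (p : {poly K}) : series K :=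
  fun n => (p \Po ('X + 1))`_n.

(* r in K(t) and a in K[[t-1]] are the same element of K((t-1)). *)
Definition expands (r : ratfun K) (a : series K) : Prop :=
  exists p q : {poly K}, [/\ q != 0, r = tofrac p / tofrac q &
    series_mul (poly_series q) a =1 poly_series p].

(* phi_D^* : K -> K(t).  The element r below is unique when it exists, and it
   exists for every f when D is rational semisimple; 0 is a dummy value. *)
Definition phi_comorphism (D : K -> K) (f : K) : ratfun K :=
  xget 0 [set r | expands r (phi_series D f)]%classic.

Definition rational_slice (phi : K -> ratfun K) (s : K) : Prop :=
  phi s = ratfun_t * ratfun_const s.

End RationalSlices.

(* Main.v *)
(* The series F = exp(log(1 + u)) satisfies (1 + u) F' = F and F(0) = 1, so
   F = 1 + u; hence D s = s makes phi_D^*(s) expand to s (1 + u) = s t in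
   K[[u]], u = t - 1.  Conversely, the coefficient of u in phi_D^*(s) is D s,
   while that of t s is s. *)
Require Import Defs.
From mathcomp Require Import boolp classical_sets.
From mathcomp Require Import all_boot all_order all_algebra.
Set Implicit Arguments.
Unset Strict Implicit.
Unset Printing Implicit Defensive.

Import GRing.Theory.
Local Open Scope ring_scope.

(* The polynomial p represents the power series a modulo X^N. *)
Definition agree (K : fieldType) (N : nat) (p : {poly K}) (a : series K) :=
  forall i, (i < N)%N -> p`_i = a i.

Section Series.
Variable K : fieldType.
Implicit Types (a b c : series K) (p q : {poly K}).

Lemma agree_poly N a : agree N (\poly_(i < N) a i) a.
Proof. by move=> i ltiN; rewrite coef_poly ltiN. Qed.

(** A coefficient of a product in degree below [N] involves only coefficients below [N], so ring
    laws and calculus in [{poly K}] pass to series by truncation. *)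
Lemma agreeM N p q a b :
  agree N p a -> agree N q b -> agree N (p * q) (series_mul a b).
Proof.
move=> pa qb i ltiN; rewrite coefM; apply: eq_bigr => j _.
rewrite pa ?qb //; first exact: leq_ltn_trans (leq_subr _ _) ltiN.
by apply: leq_ltn_trans ltiN; rewrite -ltnS.
Qed.

Lemma agreeX N p a n : agree N p a -> agree N (p ^+ n) (series_pow a n).
Proof.
move=> pa; elim: n => [|n IHn]; first by move=> i _; rewrite coef1.
by rewrite exprS; apply: agreeM.
Qed.

Lemma poly_series_inj p q : poly_series p =1 poly_series q -> p = q.
Proof.
move=> pq; rewrite -[p](comp_polyXaddC_K _ 1) -[q](comp_polyXaddC_K _ 1).
by congr (_ \Po _); apply/polyP => i; apply: pq.
Qed.

Lemma poly_seriesM p q :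
  poly_series (p * q) =1 series_mul (poly_series p) (poly_series q).
Proof. by move=> n; rewrite /poly_series comp_polyM coefM. Qed.

Lemma poly_series_neq0 p : p != 0 -> exists n, poly_series p n != 0.
Proof.
move=> p0; have [//|noc] := pselect (exists n, poly_series p n != 0).
case/eqP: p0; apply: poly_series_inj => n; rewrite /poly_series comp_poly0 coef0.
by apply/eqP; apply: contra_notT noc => nz; exists n.
Qed.

Lemma series_mulI b a c : (exists n, b n != 0) ->
  series_mul b a =1 series_mul b c -> a =1 c.
Proof.
move=> exb; case: (ex_minnP exb) => m bm0 mmin eqbac n.
(* With [m] the order of [b], the coefficient of degree [m + n] isolates [b m * a n]: terms with
   [i < m] vanish, and those with [i > m] involve [a] only below [n]. *)
elim/ltn_ind: n => n IHn; have /eqP := eqbac (m + n)%N.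
have ltm : (m < (m + n).+1)%N by rewrite ltnS leq_addr.
rewrite /series_mul [eqbLHS](bigD1 (Ordinal ltm)) //=.
rewrite [eqbRHS](bigD1 (Ordinal ltm)) //= addKn.
rewrite (eq_bigr (fun i : 'I_(m + n).+1 => b i * c (m + n - i)%N)) => [|i].
  by rewrite (inj_eq (addIr _)) (inj_eq (mulfI bm0)) => /eqP.
rewrite -val_eqE /= neq_ltn => /orP[ltim|ltmi].
  have [->|/mmin] := eqVneq (b i) 0; first by rewrite !mul0r.
  by rewrite leqNgt ltim.
by rewrite IHn // ltn_subLR ?ltn_add2r // -ltnS.
Qed.

Lemma series_mulCA a b c :
  series_mul a (series_mul b c) =1 series_mul b (series_mul a c).
Proof.
move=> n; have tr x := @agree_poly n.+1 x.
rewrite -(agreeM (tr a) (agreeM (tr b) (tr c))) // mulrCA.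
by apply: (agreeM (N := n.+1)) => //; apply: agreeM.
Qed.

Lemma eq_series_mul a b c : b =1 c -> series_mul a b =1 series_mul a c.
Proof. by move=> bc n; apply: eq_bigr => i _; rewrite bc. Qed.

Lemma series_mul1 a : series_mul (series_one K) a =1 a.
Proof.
move=> n; rewrite /series_mul big_ord_recl subn0 mul1r big1 ?addr0 // => i _.
by rewrite mul0r.
Qed.

(** Cross-multiplying, [q' p] and [q p'] both expand to [q q' a]. This makes the choice in
    [phi_comorphism] canonical. *)
Lemma expands_uniq (r r' : ratfun K) a : expands r a -> expands r' a -> r = r'.
Proof.
move=> [p [q [q0 -> qa]]] [p' [q' [q'0 -> q'a]]].
apply/eqP; rewrite eqr_div ?tofrac_eq0 // -!tofracM tofrac_eq; apply/eqP.
apply: poly_series_inj => n; rewrite (mulrC p) (mulrC p') !poly_seriesM.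
by rewrite -(eq_series_mul _ qa) -(eq_series_mul _ q'a) series_mulCA.
Qed.

Lemma expands_poly p a : expands (tofrac p) a <-> a =1 poly_series p.
Proof.
split=> [[p' [q [q0 /eqP]]]|ap]; last first.
  exists p, 1; split; rewrite ?oner_neq0 ?tofrac1 ?divr1 // => n.
  rewrite -ap -[RHS]series_mul1; apply: eq_bigr => i _.
  by rewrite /poly_series comp_polyC coefC; case: (i : nat).
rewrite eq_sym -(inj_eq (mulIf (_ : tofrac q != 0))) ?tofrac_eq0 //.
rewrite divfK ?tofrac_eq0 // -tofracM tofrac_eq => /eqP -> qa.
apply: (series_mulI (b := poly_series q)); first exact: poly_series_neq0.
by move=> n; rewrite qa mulrC poly_seriesM.
Qed.

Lemma expands_ts (s : K) a : expands (ratfun_t K * ratfun_const s) a <->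
  a =1 (fun n => s * (n <= 1)%:R).
Proof.
rewrite -tofracM expands_poly; have -> : poly_series ('X * s%:P) =
    (fun n => s * (n <= 1)%:R).
  apply/funext => n; rewrite /poly_series comp_polyM comp_polyX comp_polyC.
  rewrite coefMC coefD coefX coef1 mulrC.
  by case: n => [|[|n]] //=; rewrite ?add0r ?addr0.
by [].
Qed.

End Series.

Section ExpLog.
Variables (K : fieldType) (charK : [pchar K] =i pred0).

Let P := series_pow (log_series K).

Lemma natr_neq0 n : n.+1%:R != 0 :> K.
Proof. by rewrite (pcharf0P K).1. Qed.

(** The logarithm has no constant term, so each factor raises the order by at least one. *)
Lemma log_pow_small n m : (m < n)%N -> P n m = 0.
Proof.
elim: n m => // n IHn m ltmn; rewrite /P /= /series_mul big1 // => -[i lim] _ /=.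
case: i lim => [|i] lim; first by rewrite mul0r.
rewrite [series_pow _ _ _]IHn ?mulr0 // ltn_subLR //.
by apply: leq_trans ltmn _; rewrite addSn ltnS leq_addl.
Qed.

(* The coefficient of u^m in (1 + u) (L^(n+1))' = (n + 1) L^n, L = log(1 + u). *)
Lemma log_pow_rec n m :
  P n.+1 m.+1 *+ m.+1 + P n.+1 m *+ m = P n m *+ n.+1.
Proof.
pose L : {poly K} := \poly_(i < m.+2) log_series K i.
have LP j : agree m.+2 (L ^+ j) (P j) by apply/agreeX/agree_poly.
(* The derivative of the truncated logarithm is a finite geometric sum in [- 'X]; the telescoping
   error has order [m + 1] and cannot reach the coefficient of degree [m]. *)
have L' : L^`() * (1 + 'X) = 1 - (- 'X) ^+ m.+1.
  have -> : L^`() = \sum_(i < m.+1) (- 'X) ^+ i.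
    transitivity (\poly_(i < m.+1) (-1) ^+ i : {poly K}).
      apply/polyP => i; rewrite coef_deriv !coef_poly ltnS.
      case: ifP => _; last by rewrite mul0rn.
      by rewrite -mulr_natr divfK ?natr_neq0 // 2!exprS !mulN1r opprK.
    rewrite poly_def; apply: eq_bigr => i _.
    by rewrite -mul_polyC rmorphXn rmorphN1 -exprNn.
  by rewrite -[RHS]opprB subrX1 -mulNr opprB opprK mulrC.
rewrite -!LP //.
transitivity (((L ^+ n.+1)^`() * (1 + 'X))`_m).
  rewrite mulrDr mulr1 coefD coefMX !coef_deriv; congr (_ + _).
  by case: (m) => //=; rewrite mulr0n.
rewrite deriv_exp /= mulrnAl mulrAC L' coefMn; congr (_ *+ _).
by rewrite mulrBl mul1r coefB exprNn mulrAC coefMXn ltnSn subr0.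
Qed.

Lemma exp_log m : \sum_(n < m.+1) P n m / n`!%:R = (m <= 1)%:R.
Proof.
pose c m := \sum_(n < m.+1) P n m / n`!%:R.
(* This is [(1 + u) F' = F] in degree [j]: divide [log_pow_rec] by [(n + 1)!] and sum over [n]. *)
have crec j : c j.+1 *+ j.+1 + c j *+ j = c j.
  have -> : c j.+1 = \sum_(n < j.+1) P n.+1 j.+1 / n.+1`!%:R.
    by rewrite /c big_ord_recl mul0r add0r.
  (* The extra term [n = j + 1] is zero by the order bound; it aligns the ranges once the term
     [n = 0] is split off. *)
  have cj : c j = \sum_(n < j.+2) P n j / n`!%:R.
    by rewrite [RHS]big_ord_recr [P _ _]log_pow_small // mul0r [RHS]addr0.
  have -> : c j *+ j = \sum_(n < j.+1) P n.+1 j / n.+1`!%:R *+ j.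
    rewrite cj sumrMnl big_ord_recl mulrnDl /= /P /= /series_one.
    by case: (j) => [|i]; rewrite ?mulr0n ?mul0r ?mul0rn ?add0r.
  rewrite -sumrMnl -big_split /=; apply: eq_bigr => n _.
  rewrite -!mulrnAl -mulrDl log_pow_rec factS natrM invfM mulrA -[_ *+ _]mulr_natr.
  by rewrite mulfK ?natr_neq0.
have c1 : c 1 = 1.
  by have := crec 0; rewrite mulr0n addr0 mulr1n => ->; rewrite /c big_ord1 divr1.
rewrite -/(c m); case: m => [|[|m]] //.
  by rewrite /c big_ord1 divr1.
(* The premise holds for [j = 0] trivially, and afterwards because both sides are zero. *)
have c0 j : c j.+1 *+ j.+1 = c j.+1 -> c j.+2 = 0.
  move=> cj; have /eqP := crec j.+1; rewrite cj addrC -subr_eq0 addrAC subrr add0r.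
  by rewrite -mulr_natr mulf_eq0 (negPf (natr_neq0 _)) orbF => /eqP.
by elim: m => [|m IHm]; apply: c0; rewrite ?IHm ?mul0rn.
Qed.

Lemma phi_series_fix (D : K -> K) s : D s = s ->
  phi_series D s =1 (fun n => s * (n <= 1)%:R).
Proof.
move=> Ds m; rewrite -exp_log mulr_sumr; apply: eq_bigr => n _.
by rewrite /exp_series iter_fix // mulrAC mulrA.
Qed.

End ExpLog.

(** Only the first power of the logarithm contributes in degree 1, with coefficient 1. *)
Lemma phi_series1 (K : fieldType) (D : K -> K) s : phi_series D s 1 = D s.
Proof.
rewrite /phi_series /sigma /series_subst !big_ord_recl big_ord0 /=.
rewrite /exp_series /series_mul !big_ord_recl !big_ord0 /= /series_one /log_series.
by rewrite /= !(mulr0, mul0r, add0r, addr0, divr1, mulr1, expr2, mulrNN).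
Qed.

Theorem corollary3p3 (k : closedFieldType) (hk : [pchar k] =i pred0)
    (K : fieldType) (iota : {rmorphism k -> K}) (hK : is_function_field iota)
    (D : K -> K) (hD : rational_semisimple iota D) (s : K) :
  rational_slice (phi_comorphism D) s <-> D s = s.
Proof.
have charK : [pchar K] =i pred0 by move=> p; rewrite (fmorph_pchar iota).
rewrite /rational_slice /phi_comorphism; split=> [|Ds].
  case: xgetP => [r _ exr rts|_ /eqP].
    by move: exr; rewrite rts => /expands_ts/(_ 1); rewrite phi_series1 mulr1.
  (* With no expansion, the dummy value gives [0 = t s], hence [s = 0], and [D 0 = 0] by
     linearity. *)
  rewrite eq_sym mulf_eq0 !tofrac_eq0 polyX_eq0 polyC_eq0 /= => /eqP ->.
  by have := derivationZ hD.1 0 0; rewrite rmorph0 !mul0r.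
(* Here [t s] itself is an expansion, so by uniqueness it is the chosen value. *)
have ts := (expands_ts _ _).2 (phi_series_fix charK Ds).
by apply: xget_unique => // r /expands_uniq; apply.
Qed.
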